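(* Let $(\mathcal M,g)$ be a $d$-dimensional Riemannian manifold, $x,x'\in\mathcal M$, and let $\mathcal T_{x\to x'}:\mathrm T_x\mathcal M\to\mathrm T_{x'}\mathcal M$ be an isometric vector transport, i.e. a linear map with $\langle\mathcal T_{x\to x'}u,\mathcal T_{x\to x'}v\rangle_{x'}=\langle u,v\rangle_x$ for all $u,v\in\mathrm T_x\mathcal M$. Let $B,\Xi\subset\mathrm T_x\mathcal M$ be subspaces with $\dim B=\dim\Xi=\ell$ and $\mathcal F:B\to\Xi$ a full-rank linear map, with sketching operator $\mathcal P_{x,B,\Xi}=\mathcal F\,\Pi_B$. Define $$B':=\mathcal T_{x\to x'}(B),\qquad \Xi':=\mathcal T_{x\to x'}(\Xi),\qquad \mathcal F':=\bigl(\mathcal T_{x\to x'}\vert_{\Xi}\bigr)\,\mathcal F\,\bigl(\mathcal T_{x\to x'}\vert_{B}\bigr)^{-1}:B'\to\Xi',$$ and the transported sketching operator $\mathcal P_{x',B',\Xi'}:=\mathcal F'\,\Pi_{B'}$. If the Haar--Grassmann sketching condition holds at $x$ for $\mathcal P_{x,B,\Xi}$, then $\mathcal P_{x',B',\Xi'}$ satisfies the Haar--Grassmann sketching condition at $x'$.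
   Context: $\langle\cdot,\cdot\rangle_x$ is the inner product on $\mathrm T_x\mathcal M$ given by $g_x$; self-adjointness, isometries and operator norms on $\mathrm T_x\mathcal M$ are with respect to it; $\Pi_V$ is the orthogonal projection onto $V$ in the relevant tangent space. Haar--Grassmann sketching condition at a point $x$. For an $\ell$-dimensional subspace $B\subset\mathrm T_x\mathcal M$, a random $\ell$-dimensional subspace $\Xi\subset\mathrm T_x\mathcal M$ and a random full-rank linear map $\mathcal F:B\to\Xi$, the sketching operator is $\mathcal P_{x,B,\Xi}=\mathcal F\,\Pi_B$. The subspace $B$ is fixed (all probabilities and expectations are conditional on $B$). Write the polar decomposition $\mathcal F=\mathcal U\mathcal R$, with $\mathcal U:B\to\Xi$ a linear isometry and $\mathcal R:B\to B$ $g_x$-self-adjoint positive definite. The condition requires: (i) $\Xi$ is Haar-uniform on the Grassmannian $\mathrm{Gr}(\ell,\mathrm T_x\mathcal M)$ of $\ell$-dimensional subspaces (its law is the unique probability measure invariant under all $g_x$-isometries of $\mathrm T_x\mathcal M$); (ii) almost surely $\operatorname{rank}(\mathcal F)=\ell$, and conditionally on $\Xi$ the isometry $\mathcal U$ is Haar-uniform on the set of all linear isometries from $B$ to $\Xi$ (the unique probability law invariant under right composition with orthogonal operators of $B$), and $\mathcal U$ is independent of $\mathcal R$; (iii) $\mathbb E[\mathcal R^2]=d\,\mathrm{Id}_B$ and $\mathbb E[\|\mathcal R^{-1}\|_{\mathrm{op}}^2]<\infty$. The transport $\mathcal T_{x\to x'}$ is deterministic (not random). *)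

(* Defs.v *)
From HB Require Import structures.
From mathcomp Require Import all_boot all_order all_algebra.
From mathcomp Require Import all_classical all_reals all_analysis.
Set Implicit Arguments.
Unset Strict Implicit.
Unset Printing Implicit Defensive.
Import Order.TTheory GRing.Theory Num.Theory.
Import numFieldNormedType.Exports.
Local Open Scope classical_set_scope.
Local Open Scope ring_scope.

(* Intended for U open; the values of f outside U are irrelevant. *)
Fixpoint Ck_on {R : realType} {V W : normedModType R} (k : nat) (U : set V)
    (f : V -> W) : Prop :=
  {within U, continuous f} /\
  if k is k'.+1 then
    forall v : V, (forall x, U x -> derivable f x v) /\
                  Ck_on k' U (fun x => 'D_v f x)
  else True.

Definition smooth_on {R : realType} {V W : normedModType R} (U : set V)
    (f : V -> W) : Prop := forall k, Ck_on k U f.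

(* [chart_inv] is total, but only meaningful on [chart_fun @` chart_dom]. *)
Record chart (R : realType) (d : nat) (M : topologicalType) := Chart {
  chart_dom : set M;
  chart_fun : M -> 'rV[R]_d;
  chart_inv : 'rV[R]_d -> M;
  chart_dom_open : open chart_dom;
  chart_img_open : open (chart_fun @` chart_dom);
  chart_funK : forall x, chart_dom x -> chart_inv (chart_fun x) = x;
  chart_fun_continuous : {within chart_dom, continuous chart_fun};
  chart_inv_continuous :
    {within chart_fun @` chart_dom, continuous chart_inv} }.

(* The tangent bundle is given by the tangent spaces together with the
   differentials [dchart a x] of the charts; [dchart_bij] and [dchart_change]
   determine it up to a unique isomorphism. *)
Record riemannianManifold (R : realType) (d : nat) := RiemannianManifold {
  carrier :> topologicalType;
  carrier_hausdorff : hausdorff_space carrier;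
  carrier_second_countable : @second_countable carrier;
  atlas : set (chart R d carrier);
  atlas_cover : forall x, exists2 a, atlas a & chart_dom a x;
  atlas_smooth : forall a b, atlas a -> atlas b ->
    smooth_on (chart_fun a @` (chart_dom a `&` chart_dom b))
      (chart_fun b \o chart_inv a);
  tangent : carrier -> vectType R;
  dchart : chart R d carrier -> forall x, 'Hom(tangent x, 'rV[R]_d);
  dchart_bij : forall a x, atlas a -> chart_dom a x ->
    lker (dchart a x) = 0%VS /\ limg (dchart a x) = fullv;
  dchart_change : forall a b x (v : tangent x), atlas a -> atlas b ->
    chart_dom a x -> chart_dom b x ->
    dchart b x v =
      'D_(dchart a x v) (chart_fun b \o chart_inv a) (chart_fun a x);
  metric : forall x, {dot (tangent x) for idfun};
  metric_smooth : forall a (w1 w2 : 'rV[R]_d), atlas a ->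
    smooth_on (chart_fun a @` chart_dom a)
      (fun y => metric (chart_inv a y)
                  ((dchart a (chart_inv a y))^-1%VF w1)
                  ((dchart a (chart_inv a y))^-1%VF w2) : R^o) }.

Section inner_product.
Context {R : realType}.

Definition isometric {V W : vectType R} (g : V -> V -> R) (h : W -> W -> R)
    (T : 'Hom(V, W)) : Prop :=
  forall u v, h (T u) (T v) = g u v.

Definition restrict_ip {V : vectType R} (g : V -> V -> R) (B : {vspace V}) :
    subvs_of B -> subvs_of B -> R :=
  fun u v => g (vsval u) (vsval v).

Definition self_adjoint {V : vectType R} (g : V -> V -> R) (A : 'End(V)) :
    Prop :=
  forall u v, g (A u) v = g u (A v).

Definition positive_definite {V : vectType R} (g : V -> V -> R)
    (A : 'End(V)) : Prop :=
  self_adjoint g A /\ forall u, u != 0 -> 0 < g (A u) u.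

Definition op_norm {V : vectType R} (g : V -> V -> R) (A : 'End(V)) : R :=
  sup [set Num.sqrt (g (A u) (A u)) | u in [set u | Num.sqrt (g u u) <= 1]].

Definition orthproj {V : vectType R} (g : {dot V for idfun})
    (W : {vspace V}) : 'End(V) :=
  daddv_pi W (orthov g W).

(* F is only defined on B, so the projection is corestricted to B. *)
Definition sketching_operator {V : vectType R} (g : {dot V for idfun})
    (B : {vspace V}) (F : 'Hom(subvs_of B, V)) : 'End(V) :=
  (F \o (linfun (vsproj B) \o orthproj g B))%VF.

(* The restriction of T to B, as a map onto T(B). *)
Definition restrict_lfun {V W : vectType R} (T : 'Hom(V, W))
    (B : {vspace V}) : 'Hom(subvs_of B, subvs_of (T @: B)%VS) :=
  (linfun (vsproj (T @: B)%VS) \o (T \o linfun vsval))%VF.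

End inner_product.

(* The Borel sigma-algebra of a finite-dimensional real vector space is the one
   generated by its linear forms. *)
Section borel.
Context {R : realType} (V : vectType R).

Definition pointed_vect : Type := V.
HB.instance Definition _ := Choice.copy pointed_vect V.
HB.instance Definition _ := isPointed.Build pointed_vect (0 : V).

Definition linear_form_sets : set (set pointed_vect) :=
  [set A | exists (f : 'Hom(V, R^o)) (Y : set R),
             measurable Y /\ A = (fun v : V => f v : R) @^-1` Y].

End borel.
Arguments linear_form_sets {R} V.

Notation borel_vect V := (g_sigma_algebraType (linear_form_sets V)).

(* The Borel sigma-algebra of the disjoint union of the Grassmannians of V, a
   subspace W being identified with the orthogonal projection onto W. *)
Section grassmannian.
Context {R : realType} (V : vectType R) (g : {dot V for idfun}).

Definition pointed_vspace : Type := {vspace V}.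
HB.instance Definition _ := Choice.copy pointed_vspace {vspace V}.
HB.instance Definition _ := isPointed.Build pointed_vspace (0%VS : {vspace V}).

Definition projection_sets : set (set pointed_vspace) :=
  preimage_set_system setT (orthproj g : pointed_vspace -> borel_vect 'End(V))
    measurable.

End grassmannian.

Notation grassmannian g := (g_sigma_algebraType (projection_sets g)).

Section haar_grassmann.
Context {R : realType} {V : vectType R} (g : {dot V for idfun}).

(* Invariance characterizes the Haar law among the laws on l-dimensional
   subspaces; similarly for [haar_on_isometries]. *)
Definition haar_on_grassmannian (l : nat)
    (mu : set (grassmannian g) -> \bar R) : Prop :=
  mu [set W : {vspace V} | \dim W = l] = 1%E /\
  forall Q : 'End(V), isometric g g Q ->
  forall C : set (grassmannian g), measurable C ->
    mu ((fun W : {vspace V} => (Q @: W)%VS) @^-1` C) = mu C.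

Definition haar_on_isometries (B W : {vspace V})
    (mu : set (borel_vect 'Hom(subvs_of B, V)) -> \bar R) : Prop :=
  mu [set U : 'Hom(subvs_of B, V) |
       isometric (restrict_ip g (B := B)) g U /\ (limg U <= W)%VS] = 1%E /\
  forall Q : 'End(subvs_of B),
    isometric (restrict_ip g (B := B)) (restrict_ip g (B := B)) Q ->
  forall A : set (borel_vect 'Hom(subvs_of B, V)), measurable A ->
    mu ((fun U : 'Hom(subvs_of B, V) => (U \o Q)%VF) @^-1` A) = mu A.

Definition polar_decomposition (B W : {vspace V}) (F : 'Hom(subvs_of B, V))
    (U : 'Hom(subvs_of B, V)) (S : 'End(subvs_of B)) : Prop :=
  [/\ F = (U \o S)%VF,
      isometric (restrict_ip g (B := B)) g U,
      (limg U <= W)%VS &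
      positive_definite (restrict_ip g (B := B)) S].

Context {dsp : measure_display} {Omega : measurableType dsp}
  (P : probability Omega R).

(* [kappa] is a regular conditional law of [U] given [Xi]. *)
Definition conditionally_haar (B : {vspace V}) (Xi : Omega -> {vspace V})
    (U : Omega -> 'Hom(subvs_of B, V)) : Prop :=
  exists kappa :
      R.-pker (grassmannian g) ~> (borel_vect 'Hom(subvs_of B, V)),
    (forall (C : set (grassmannian g))
            (A : set (borel_vect 'Hom(subvs_of B, V))),
       measurable C -> measurable A ->
       P (Xi @^-1` C `&` U @^-1` A) =
         (\int[P]_(w in Xi @^-1` C) kappa (Xi w) A)%E) /\
    {ae P, forall w, @haar_on_isometries B (Xi w) (kappa (Xi w))}.

Definition independent_maps {V1 V2 : vectType R} (X : Omega -> V1)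
    (Y : Omega -> V2) : Prop :=
  forall (A1 : set (borel_vect V1)) (A2 : set (borel_vect V2)),
    measurable A1 -> measurable A2 ->
    P (X @^-1` A1 `&` Y @^-1` A2) = (P (X @^-1` A1) * P (Y @^-1` A2))%E.

(* The expectation of a random endomorphism is taken entrywise. *)
Definition has_expectation {W : vectType R} (h : W -> W -> R)
    (X : Omega -> 'End(W)) (A : 'End(W)) : Prop :=
  forall u v, P.-integrable setT (EFin \o (fun w => h (X w u) v)) /\
    ('E_P[fun w => h (X w u) v] = (h (A u) v)%:E)%E.

(* [d] is the dimension of the ambient manifold and [Pop] the sketching operator
   F o Pi_B, which determines F.  The polar factors U and S are unique wherever F
   has full rank, hence almost surely. *)
Definition haar_grassmann (d l : nat) (B : {vspace V})
    (Xi : Omega -> {vspace V}) (Pop : Omega -> 'End(V)) : Prop :=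
  [/\ \dim B = l,
      forall w, \dim (Xi w) = l,
      measurable_fun setT (Xi : Omega -> grassmannian g) &
  exists F : Omega -> 'Hom(subvs_of B, V),
  [/\ forall w, (limg (F w) <= Xi w)%VS,
      measurable_fun setT (F : Omega -> borel_vect 'Hom(subvs_of B, V)),
      forall w, Pop w = sketching_operator g (F w) &
  exists (U : Omega -> 'Hom(subvs_of B, V)) (S : Omega -> 'End(subvs_of B)),
  [/\ measurable_fun setT (U : Omega -> borel_vect 'Hom(subvs_of B, V)),
      measurable_fun setT (S : Omega -> borel_vect 'End(subvs_of B)),
      {ae P, forall w, polar_decomposition (Xi w) (F w) (U w) (S w)} &
  [/\ haar_on_grassmannian l (fun C => P (Xi @^-1` C)),
      [/\ {ae P, forall w, \dim (limg (F w)) = l},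
          conditionally_haar Xi U &
          independent_maps U S] &
      has_expectation (restrict_ip g (B := B)) (fun w => (S w \o S w)%VF)
        (d%:R *: \1%VF) /\
      ('E_P[fun w => (op_norm (restrict_ip g (B := B)) (S w)^-1%VF ^+ 2)%R]
         < +oo)%E ]]]].

End haar_grassmann.

(* Main.v *)
Require Import Defs.
From HB Require Import structures.
From mathcomp Require Import all_boot all_order all_algebra.
From mathcomp Require Import all_classical all_reals all_analysis.
From mathcomp Require Import measurable_realfun.
Import Order.TTheory GRing.Theory Num.Theory.
Import HBNNSimple.
Local Open Scope classical_set_scope.
Local Open Scope ring_scope.

(* Both tangent spaces have dimension d, so T is an isometric isomorphism; write
   t : B -> T(B) for its restriction.  Everything is carried to x' by conjugation:
   F' = T F t^-1 has polar factors U' = T U t^-1 and S' = t S t^-1, the orthogonal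
   projection onto T(Xi) is T Pi_Xi T^-1, and the conditional law of U' is the
   image of that of U.  Isometries at x' are conjugate to isometries at x, which
   gives both Haar properties, and the moment conditions are invariant under
   conjugation by an isometry. *)

(* Neither function is assumed measurable: the integral of a nonnegative function
   is a supremum over the simple functions below it. *)
Lemma ge0_ae_le_lower_integral {d} {T : measurableType d} {R : realType}
    (mu : {measure set T -> \bar R}) (f g : T -> \bar R) :
  (forall x, (0 <= f x)%E) -> (forall x, (0 <= g x)%E) ->
  {ae mu, forall x, (f x <= g x)%E} ->
  (\int[mu]_x f x <= \int[mu]_x g x)%E.
Proof.
move=> f0 g0 [N [mN N0 subN]].
rewrite !ge0_integralTE//; apply: ge_ereal_sup => _ [h /= hf <-].
apply: ereal_sup_ubound => /=.
(* Zeroing [h] on the null set [N] puts it below [g] everywhere and does not change its integral. *)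
pose h' := mul_nnsfun h (indic_nnsfun R (measurableC mN)).
have h'E x : h' x = h x * \1_(~` N) x by [].
exists h'.
  move=> x; rewrite h'E indicE in_setC; case: (boolP (x \in N)) => xN /=.
    by rewrite mulr0.
  rewrite mulr1 (le_trans (hf x))//; apply: contrapT => gf.
  by move: xN; rewrite notin_setE; apply; exact: subN.
rewrite -!integralT_nnsfun.
apply: ge0_ae_eq_integral => //.
- exact/measurable_EFinP/measurable_funTS.
- exact/measurable_EFinP/measurable_funTS.
- by move=> x _; rewrite lee_fin; exact: fun_ge0.
- by move=> x _; rewrite lee_fin; exact: fun_ge0.
exists N; split => // x /= H; apply: contrapT => xN; apply: H => _.
by rewrite -[LHS]/(h' x)%:E h'E indicE in_setC (memNset xN) mulr1.
Qed.

(** * Images of probability kernels under measurable maps *)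

Section kernel_map.
Context {d1 d2 d3 d4 : measure_display} {R : realType}.
Context {X : measurableType d1} {Y : measurableType d2}.
Context {X' : measurableType d3} {Y' : measurableType d4}.
Context (k : R.-pker X ~> Y) (f : X' -> X) (h : Y -> Y').
Context (mf : measurable_fun setT f) (mh : measurable_fun setT h).

(** The measurability proof is an argument so that the measure structure, whose sigma-additivity
    depends on it, can be inferred from the term; [kernel_map] takes one for [f] likewise. *)
Definition kernel_map_measure of measurable_fun setT h :=
  fun x : X' => pushforward (k (f x)) h.

Let kernel_map0 x : kernel_map_measure mh x set0 = 0%E.
Proof. exact: measure0. Qed.

Let kernel_map_ge0 x A : (0 <= kernel_map_measure mh x A)%E.
Proof. exact: measure_ge0. Qed.

Let kernel_map_sigma_additive x : semi_sigma_additive (kernel_map_measure mh x).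
Proof. exact: measure_semi_sigma_additive. Qed.

HB.instance Definition _ x := isMeasure.Build _ _ _ (kernel_map_measure mh x)
  (kernel_map0 x) (kernel_map_ge0 x) (@kernel_map_sigma_additive x).

Definition kernel_map of measurable_fun setT f :=
  fun x : X' => kernel_map_measure mh x : {measure set Y' -> \bar R}.

Let measurable_kernel_map A : measurable A ->
  measurable_fun setT (kernel_map mf ^~ A).
Proof.
move=> mA; apply: (measurableT_comp (measurable_kernel k (h @^-1` A) _) mf).
by rewrite -[X in measurable X]setTI; exact: mh.
Qed.

HB.instance Definition _ :=
  isKernel.Build _ _ _ _ _ (kernel_map mf) measurable_kernel_map.

Let kernel_map_prob x : kernel_map mf x setT = 1%E.
Proof.
by rewrite /= /kernel_map_measure /pushforward preimage_setT prob_kernel.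
Qed.

HB.instance Definition _ :=
  Kernel_isProbability.Build _ _ _ _ _ (kernel_map mf) kernel_map_prob.

End kernel_map.
Arguments kernel_map {d1 d2 d3 d4 R X Y X' Y'} k {f h}.

(** * Conjugation and measurability of linear maps *)

Section conjugation.
Context {K : fieldType} {V1 V2 W1 W2 : vectType K}.

(** The outer maps are independent because a map from [B] to the ambient space is composed with [T]
    on one side and with the inverse of the restriction of [T] on the other. *)
Definition lfun_conj (f : 'Hom(V2, W2)) (h : 'Hom(W1, V1)) (u : 'Hom(V1, V2)) :
  'Hom(W1, W2) := (f \o (u \o h))%VF.

Lemma lfun_conjE f h u x : lfun_conj f h u x = f (u (h x)).
Proof. by rewrite !comp_lfunE. Qed.

Lemma lfun_conj_is_linear f h : linear (lfun_conj f h).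
Proof.
move=> a u v; apply/lfunP => x.
by rewrite !(comp_lfunE, add_lfunE, scale_lfunE) linearP.
Qed.

HB.instance Definition _ f h :=
  GRing.isLinear.Build K _ _ _ (lfun_conj f h) (lfun_conj_is_linear f h).

End conjugation.

(** A linear form composed with [f] is a linear form, so generating sets pull back to generating
    sets. *)
Lemma measurable_linear {R : realType} {V W : vectType R}
    (f : {linear V -> W}) :
  measurable_fun setT (f : borel_vect V -> borel_vect W).
Proof.
apply: (@measurability _ _ (borel_vect V) (borel_vect W) setT f
  (linear_form_sets W)) => //.
move=> _ [_ [phi [Y [mY ->]]] <-]; rewrite setTI.
apply: sub_sigma_algebra; exists (phi \o linfun f)%VF, Y; split=> //.
by apply/seteqP; split => v /=; rewrite lfunE/= lfunE.
Qed.

(** * Orthogonal complements and projections *)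

Section orthogonal_projection.
Context {R : realType} {V : vectType R} (g : {dot V for idfun}).

Lemma dot_eq0 (u : V) : g u u = 0 -> u = 0.
Proof.
by move=> gu0; apply: contra_eq gu0 => /(neq0_dnorm_gt0 (s := g)) /gt_eqF ->.
Qed.

Lemma capv_orthov (U : {vspace V}) : (U :&: orthov g U = 0)%VS.
Proof.
apply/eqP; rewrite -subv0; apply/subvP => u; rewrite memv_cap => /andP[uU].
by move=> /mem_orthovP/(_ u uU)/dot_eq0 ->; exact: mem0v.
Qed.

(** Orthogonality to one more basis vector of [U] lowers the dimension by at most one. *)
Lemma dim_orthov_ge (U : {vspace V}) :
  (\dim {:V} <= \dim (orthov g U) + \dim U)%N.
Proof.
(* The basis is generalized to an arbitrary list, so that the induction runs on the number of
   orthogonality constraints alone. *)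
rewrite /orthov; move: (tval (vbasis U)) => s; elim: (\dim U) => [|n IHn].
  by rewrite big_ord0 addn0.
rewrite big_ord_recr /= -orthov1E addnS -addSn.
apply: (leq_trans IHn); rewrite leq_add2r.
by apply: leq_trans (leqSpred _) _; rewrite ltnS leq_dim_orthov1.
Qed.

Lemma addv_orthov (U : {vspace V}) : (U + orthov g U = fullv)%VS.
Proof.
apply/eqP; rewrite eqEdim subvf /= dimv_disjoint_sum ?capv_orthov//.
by rewrite addnC dim_orthov_ge.
Qed.

Lemma orthproj_eq (U : {vspace V}) (u p : V) :
  p \in U -> u - p \in orthov g U -> orthproj g U u = p.
Proof.
move=> pU qU; rewrite -[u](subrK p) linearD/=.
rewrite [X in _ + X]daddv_pi_id ?capv_orthov//.
(* The complement component of [u - p] is all of [u - p], so its component in [U] vanishes. *)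
have := @daddv_pi_add _ _ U (orthov g U) (u - p) (capv_orthov U).
rewrite addv_orthov memvf => /(_ isT).
rewrite [X in _ + X]daddv_pi_id ?(capvC (orthov _ _)) ?capv_orthov//.
by rewrite -[X in _ = X]add0r => /addIr ->; rewrite add0r.
Qed.

Lemma mem_orthproj (U : {vspace V}) (u : V) : orthproj g U u \in U.
Proof. exact: memv_pi. Qed.

Lemma sub_orthproj_orthov (U : {vspace V}) (u : V) :
  u - orthproj g U u \in orthov g U.
Proof.
have := @daddv_pi_add _ _ U (orthov g U) u (capv_orthov U).
rewrite addv_orthov memvf => /(_ isT) e.
by rewrite -{1}e addrC addKr memv_pi.
Qed.

End orthogonal_projection.

(** * Linear isometries and conjugation by them *)

Section linear_isometry.
Context {R : realType} {V W : vectType R}.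

Lemma isometric_inj (g : {dot V for idfun}) (h : W -> W -> R)
    (T : 'Hom(V, W)) : isometric g h T -> injective T.
Proof.
move=> Tiso u v Tuv; apply/eqP; rewrite -subr_eq0; apply/eqP/(dot_eq0 g).
(* [h] is an arbitrary function, so [h 0 0] is evaluated as [h (T 0) (T 0) = g 0 0]. *)
by rewrite -Tiso linearB/= Tuv subrr -(linear0 T) Tiso linear0l.
Qed.

Lemma isometric_inv (g : V -> V -> R) (h : W -> W -> R) (T : 'Hom(V, W))
    (T' : 'Hom(W, V)) :
  cancel T' T -> isometric g h T -> isometric h g T'.
Proof. by move=> T'K Tiso u v; rewrite -Tiso !T'K. Qed.

Lemma isometric_comp {X : vectType R} (g : V -> V -> R) (h : W -> W -> R)
    (k : X -> X -> R) (T : 'Hom(V, W)) (S : 'Hom(W, X)) :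
  isometric g h T -> isometric h k S -> isometric g k (S \o T)%VF.
Proof. by move=> Tiso Siso u v; rewrite !comp_lfunE Siso Tiso. Qed.

Context (g : V -> V -> R) (h : W -> W -> R) (T : 'Hom(V, W)) (T' : 'Hom(W, V)).
Hypotheses (TK : cancel T T') (T'K : cancel T' T).
Hypothesis (Tiso : isometric g h T).

Lemma positive_definite_conj (A : 'End(V)) :
  positive_definite g A -> positive_definite h (lfun_conj T T' A).
Proof.
have T'iso := isometric_inv _ _ _ _ T'K Tiso.
move=> [Asa Apos]; split => [u v|u u0]; rewrite !comp_lfunE.
  by rewrite -{1}[v]T'K -{2}[u]T'K !Tiso Asa.
rewrite -{2}[u]T'K Tiso Apos//; apply: contra_neq u0 => T'u0.
by rewrite -[u]T'K T'u0 linear0.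
Qed.

Lemma op_norm_conj (A : 'End(V)) : op_norm h (lfun_conj T T' A) = op_norm g A.
Proof.
have T'iso := isometric_inv _ _ _ _ T'K Tiso.
rewrite /op_norm; congr (sup _); apply/seteqP; split => _ [u /= u1 <-].
  by exists (T' u); rewrite /= ?T'iso// !comp_lfunE Tiso.
by exists (T u); rewrite /= ?Tiso// !comp_lfunE Tiso TK.
Qed.

Lemma lfun_conj_inv (A : 'End(V)) : lker A == 0%VS ->
  (lfun_conj T T' A)^-1%VF = lfun_conj T T' A^-1%VF.
Proof.
move=> A0; apply/lfunP => u; rewrite -[u]T'K.
have /lker0P Ainj := A0.
have fK : cancel (lfun_conj T T' A) (lfun_conj T T' A)^-1%VF.
  apply: lker0_lfunK; apply/lker0P => v w; rewrite !comp_lfunE.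
  by move=> /(can_inj TK)/Ainj/(can_inj T'K).
(* The claimed inverse is a right inverse of the conjugate; by [fK] it agrees with the left
   inverse. *)
have e : lfun_conj T T' A (lfun_conj T T' A^-1%VF (T (T' u))) = T (T' u).
  by rewrite !comp_lfunE TK lker0_lfunVK.
by rewrite -{1}e fK.
Qed.

End linear_isometry.

(** * Transport of subspaces and of their projections *)

Section subspace_image.
Context {K : fieldType} {V W : vectType K} (T : 'Hom(V, W)) (T' : 'Hom(W, V)).

Lemma lfun_img_cancel : cancel T T' -> cancel (lfun_img T) (lfun_img T').
Proof.
move=> TK U; rewrite -limg_comp (_ : (T' \o T)%VF = \1%VF) ?lim1g//.
by apply/lfunP => u; rewrite comp_lfunE TK id_lfunE.
Qed.

Lemma dim_limg_inj (U : {vspace V}) : injective T -> \dim (T @: U) = \dim U.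
Proof. by move=> /lker0P/eqP T0; rewrite limg_dim_eq// T0 capv0. Qed.

Lemma limg_fullv : cancel T T' -> limg T' = fullv.
Proof.
move=> TK; apply/eqP; rewrite eqEsubv subvf; apply/subvP => u _.
by rewrite -[u]TK memv_img ?memvf.
Qed.

End subspace_image.

Section grassmannian_transport.
Context {R : realType} {V W : vectType R}.
Context (g : {dot V for idfun}) (h : {dot W for idfun}).
Context (T : 'Hom(V, W)) (T' : 'Hom(W, V)).
Hypotheses (T'K : cancel T' T) (Tiso : isometric g h T).

(** An isometry sends [U] onto its image and the complement of [U] into the complement of that
    image, and these two properties characterize the projection. *)
Lemma orthproj_transport (U : {vspace V}) :
  orthproj h (T @: U)%VS = lfun_conj T T' (orthproj g U).
Proof.
apply/lfunP => w; rewrite !comp_lfunE -{1}[w]T'K.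
apply: orthproj_eq; first exact/memv_img/mem_orthproj.
rewrite -linearB; apply/mem_orthovP => _ /memv_imgP[v vU ->].
apply: etrans (Tiso _ _) _.
exact/mem_orthovP/vU/sub_orthproj_orthov.
Qed.

(** Seen through projections, taking images under [T] is conjugation, a linear and hence measurable
    map. *)
Lemma measurable_transport :
  measurable_fun setT ((fun U => T @: U)%VS : grassmannian g -> grassmannian h).
Proof.
apply: (@measurability _ _ (grassmannian g) (grassmannian h) _ _
  (projection_sets h)) => // _ [_ [A mA <-] <-].
rewrite !setTI; apply: sub_sigma_algebra.
exists ((lfun_conj T T' : borel_vect 'End(V) -> borel_vect 'End(W)) @^-1` A).
  rewrite -[X in measurable X]setTI.
  exact: (measurable_linear (lfun_conj T T')).
rewrite setTI; apply/seteqP.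
by split => U /=; rewrite orthproj_transport.
Qed.

End grassmannian_transport.

(** * Restriction of an isometry to a subspace *)

Section restriction.
Context {R : realType} {V W : vectType R}.
Context (g : {dot V for idfun}) (h : {dot W for idfun}) (T : 'Hom(V, W)).
Context (B : {vspace V}).
Local Notation t := (restrict_lfun T B).

Lemma restrict_lfunE (u : subvs_of B) : vsval (t u) = T (vsval u).
Proof.
by rewrite /restrict_lfun !comp_lfunE !lfunE/= vsprojK// memv_img ?subvsP.
Qed.

Hypothesis Tiso : isometric g h T.

Lemma restrict_lfun_isometric :
  isometric (restrict_ip g (B := B)) (restrict_ip h (B := (T @: B)%VS)) t.
Proof. by move=> u v; rewrite /restrict_ip !restrict_lfunE Tiso. Qed.

Lemma restrict_lfun_inj : injective t.
Proof.
move=> u v /(congr1 vsval); rewrite !restrict_lfunE.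
by move=> /(isometric_inj _ _ _ Tiso)/val_inj.
Qed.

Lemma restrict_lfunK : cancel t t^-1%VF.
Proof. by apply: lker0_lfunK; apply/lker0P; exact: restrict_lfun_inj. Qed.

Lemma restrict_lfunVK : cancel t^-1%VF t.
Proof.
move=> u; apply: limg_lfunVK; have /memv_imgP[v vB uv] := subvsP u.
apply/memv_imgP; exists (vsproj B v); first exact: memvf.
by apply: (can_inj vsvalK); rewrite restrict_lfunE vsprojK.
Qed.

End restriction.

Lemma measurable_lfun_conj_comp {R : realType} {V1 V2 W1 W2 : vectType R}
    {dsp} {Omega : measurableType dsp} (f : 'Hom(V2, W2)) (h : 'Hom(W1, V1))
    (X : Omega -> 'Hom(V1, V2)) :
  measurable_fun setT (X : Omega -> borel_vect 'Hom(V1, V2)) ->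
  measurable_fun setT
    ((fun w => lfun_conj f h (X w)) : Omega -> borel_vect 'Hom(W1, W2)).
Proof.
by move=> mX; exact: (measurableT_comp (measurable_linear (lfun_conj f h)) mX).
Qed.

Lemma sketching_operatorE {R : realType} {V : vectType R}
    (g : {dot V for idfun}) {B : {vspace V}} (F : 'Hom(subvs_of B, V)) u :
  sketching_operator g F u = F (vsproj B (orthproj g B u)).
Proof. by rewrite /sketching_operator !comp_lfunE !lfunE. Qed.

(** * Transport of the sketching condition between inner product spaces *)

Section transport.
Context {R : realType} {V W : vectType R}.
Context (g : {dot V for idfun}) (h : {dot W for idfun}).
Context (T : 'Hom(V, W)) (T' : 'Hom(W, V)) (B : {vspace V}).
Hypotheses (TK : cancel T T') (T'K : cancel T' T) (Tiso : isometric g h T).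
Context {dsp : measure_display} {Omega : measurableType dsp}
  (P : probability Omega R).

Local Notation t := (restrict_lfun T B).
Local Notation t' := (restrict_lfun T B)^-1%VF.
Local Notation B' := (T @: B)%VS.
Local Notation gB := (restrict_ip g (B := B)).
Local Notation hB := (restrict_ip h (B := B')).

Let T'iso : isometric h g T' := isometric_inv _ _ _ _ T'K Tiso.
Let tK : cancel t t' := restrict_lfunK g h T B Tiso.
Let t'K : cancel t' t := restrict_lfunVK T B.
Let tiso : isometric gB hB t := restrict_lfun_isometric g h T B Tiso.
Let t'iso : isometric hB gB t' := isometric_inv _ _ _ _ t'K tiso.

Lemma sketching_operator_transport (F : 'Hom(subvs_of B, V)) :
  sketching_operator h (lfun_conj T t' F) =
  lfun_conj T T' (sketching_operator g F).
Proof.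
apply/lfunP => w; rewrite [RHS]lfun_conjE !sketching_operatorE lfun_conjE.
rewrite (orthproj_transport g h T T' T'K Tiso) lfun_conjE.
(* The arguments of [F] are compared after applying [t] and including into [W], where both become
   [T] applied to the projection of [T' w] onto [B]. *)
congr (T (F _)); rewrite -[RHS]tK; congr (t' _).
apply: (can_inj vsvalK).
by rewrite restrict_lfunE !vsprojK ?memv_img// mem_orthproj.
Qed.

Lemma isometric_conj (U : 'Hom(subvs_of B, V)) :
  isometric gB g U -> isometric hB h (lfun_conj T t' U).
Proof.
move=> Uiso; apply: isometric_comp Tiso.
by apply: isometric_comp Uiso; exact: t'iso.
Qed.

Lemma limg_conj_sub (U : 'Hom(subvs_of B, V)) (X : {vspace V}) :
  (limg U <= X)%VS -> (limg (lfun_conj T t' U) <= T @: X)%VS.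
Proof.
move=> UX; rewrite !limg_comp; apply: limgS.
exact: subv_trans (limgS _ (subvf _)) UX.
Qed.

Lemma polar_decomposition_transport (X : {vspace V})
    (F U : 'Hom(subvs_of B, V)) (S : 'End(subvs_of B)) :
  polar_decomposition g X F U S ->
  polar_decomposition h (T @: X)%VS (lfun_conj T t' F) (lfun_conj T t' U)
    (lfun_conj t t' S).
Proof.
move=> [-> Uiso UX Spos]; split.
- by apply/lfunP => u; rewrite [RHS]comp_lfunE !(lfun_conjE _ t') comp_lfunE tK.
- exact: isometric_conj.
- exact: limg_conj_sub.
- exact: positive_definite_conj Spos.
Qed.

Lemma haar_on_grassmannian_transport (l : nat) (Xi : Omega -> {vspace V}) :
  haar_on_grassmannian (g := g) l (fun C => P (Xi @^-1` C)) ->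
  haar_on_grassmannian (g := h) l
    (fun C => P ((fun w => (T @: Xi w)%VS) @^-1` C)).
Proof.
move=> [mu1 inv]; split.
  apply: etrans mu1; congr (P _); apply/seteqP.
  by split => w /=; rewrite dim_limg_inj//; exact: can_inj TK.
move=> Q Qiso C mC.
(* Applying [T' Q T] and then [T] is applying [T] and then [Q], so invariance under this isometry on
   the preimage of [C] is the goal. *)
have Q'iso : isometric g g (lfun_conj T' T Q).
  by apply: isometric_comp T'iso; exact: isometric_comp Qiso.
have mTC : measurable ((fun U => T @: U)%VS @^-1` C : set (grassmannian g)).
  rewrite -[X in measurable X]setTI.
  exact: (measurable_transport g h T T' T'K Tiso).
rewrite -[RHS](inv _ Q'iso _ mTC); congr (P _).
by apply/seteqP; split => w /=; rewrite !limg_comp (lfun_img_cancel T' T T'K).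
Qed.

(** The relation between [mu] and [mu'] is asked on every set, so that it applies to the set of
    isometries without a proof that this set is measurable. *)
Lemma haar_on_isometries_transport (X : {vspace V})
    (mu : set (borel_vect 'Hom(subvs_of B, V)) -> \bar R)
    (mu' : set (borel_vect 'Hom(subvs_of B', W)) -> \bar R) :
  (forall A, mu' A = mu (lfun_conj T t' @^-1` A)) ->
  haar_on_isometries g (B := B) X mu ->
  haar_on_isometries h (B := B') (T @: X)%VS mu'.
Proof.
move=> mu'E [mu1 inv]; split; rewrite ?mu'E.
  apply: etrans mu1; congr (mu _); apply/seteqP; split => U /= [Uiso UX].
    have UE : U = lfun_conj T' t (lfun_conj T t' U).
      by apply/lfunP => u; rewrite (lfun_conjE _ t) (lfun_conjE _ t') TK tK.
    split.
      by rewrite UE; apply: isometric_comp T'iso; exact: isometric_comp Uiso.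
    rewrite UE -(lfun_img_cancel T T' TK X) limg_comp limgS// limg_comp.
    exact: subv_trans (limgS _ (subvf _)) UX.
  by split; [exact: isometric_conj|exact: limg_conj_sub].
move=> Q Qiso A mA; rewrite !mu'E.
have Q'iso : isometric gB gB (lfun_conj t' t Q).
  by apply: isometric_comp t'iso; exact: isometric_comp Qiso.
have mA' : measurable (lfun_conj T t' @^-1` A :
    set (borel_vect 'Hom(subvs_of B, V))).
  rewrite -[X in measurable X]setTI.
  exact: (measurable_linear (lfun_conj T t')).
rewrite -[RHS](inv _ Q'iso _ mA'); congr (mu _); apply/seteqP.
(* Right composition with [Q] corresponds to right composition with [t' Q t], because [t t']
   cancels. *)
have e (U : 'Hom(subvs_of B, V)) :
    lfun_conj T t' (U \o lfun_conj t' t Q)%VF = (lfun_conj T t' U \o Q)%VF.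
  apply/lfunP => u; rewrite [RHS]comp_lfunE !(lfun_conjE _ t').
  by rewrite comp_lfunE (lfun_conjE _ t) t'K.
by split => U /=; rewrite e.
Qed.

Lemma conditionally_haar_transport (Xi : Omega -> {vspace V})
    (U : Omega -> 'Hom(subvs_of B, V)) :
  conditionally_haar g P Xi U ->
  conditionally_haar h P (fun w => (T @: Xi w)%VS)
    (fun w => lfun_conj T t' (U w)).
Proof.
move=> [kappa [kappaE kappa_haar]].
have mT' := measurable_transport h g T' T TK T'iso.
have mL := measurable_linear (lfun_conj T t').
(* At a subspace [Y] of [W] this kernel is the image under conjugation of [kappa (T' @: Y)]; at
   [T @: Xi w] it therefore uses [kappa (Xi w)]. *)
exists (kernel_map kappa mL mT'); split.
  move=> C A mC mA.
  rewrite [LHS](kappaE ((fun U => T @: U)%VS @^-1` C : set (grassmannian g))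
      (lfun_conj T t' @^-1` A)); last 2 first.
  - rewrite -[X in measurable X]setTI.
    exact: (measurable_transport g h T T' T'K Tiso).
  - by rewrite -[X in measurable X]setTI; exact: mL.
  apply: eq_integral => w _.
  by rewrite /= /kernel_map_measure /pushforward (lfun_img_cancel T T' TK).
apply: filterS kappa_haar => w; apply: haar_on_isometries_transport => A.
by rewrite /= /kernel_map_measure /pushforward (lfun_img_cancel T T' TK).
Qed.

Lemma independent_maps_linear {V1 V2 W1 W2 : vectType R}
    (f1 : {linear V1 -> W1}) (f2 : {linear V2 -> W2})
    (X1 : Omega -> V1) (X2 : Omega -> V2) :
  independent_maps P X1 X2 -> independent_maps P (f1 \o X1) (f2 \o X2).
Proof.
move=> ind A1 A2 mA1 mA2; apply: (ind (f1 @^-1` A1) (f2 @^-1` A2));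
  rewrite -[X in measurable X]setTI.
- exact: (measurable_linear f1).
- exact: (measurable_linear f2).
Qed.

(* [_^-1] is a junk pseudo-inverse on singular maps, where it need not commute with
   conjugation; the comparison is therefore only almost sure. *)
Lemma op_norm_inv_conj_moment (S : Omega -> 'End(subvs_of B)) :
  {ae P, forall w, lker (S w) == 0%VS} ->
  ('E_P[fun w => (op_norm hB (lfun_conj t t' (S w))^-1%VF ^+ 2)%R] <=
   'E_P[fun w => (op_norm gB (S w)^-1%VF ^+ 2)%R])%E.
Proof.
(* The operator norms have not been shown measurable in [w], hence the comparison of lower
   integrals. *)
move=> S0; rewrite unlock; apply: ge0_ae_le_lower_integral => [w|w|].
- by rewrite lee_fin sqr_ge0.
- by rewrite lee_fin sqr_ge0.
apply: filterS S0 => w Sw0.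
by rewrite (lfun_conj_inv _ _ tK t'K)// (op_norm_conj _ _ _ _ tK t'K tiso).
Qed.

Lemma haar_grassmann_transport (d l : nat) (Xi : Omega -> {vspace V})
    (Pop : Omega -> 'End(V)) :
  haar_grassmann g P d l B Xi Pop ->
  haar_grassmann h P d l B' (fun w => T @: Xi w)%VS
    (fun w => lfun_conj T T' (Pop w)).
Proof.
have dimT (X : {vspace V}) : \dim (T @: X) = \dim X.
  exact/dim_limg_inj/(can_inj TK).
move=> [dimB dimXi mXi [F [FXi mF PopE [U [S [mU mS polar]]]]]].
move=> [haarXi [rankF haarU indUS] [ES2 EinvS]].
split => [|w||]; rewrite ?dimT//.
  exact: (measurableT_comp (measurable_transport g h T T' T'K Tiso) mXi).
exists (fun w => lfun_conj T t' (F w)); split.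
- by move=> w; exact: limg_conj_sub.
- exact: measurable_lfun_conj_comp.
- by move=> w; rewrite PopE sketching_operator_transport.
exists (fun w => lfun_conj T t' (U w)), (fun w => lfun_conj t t' (S w)); split.
- exact: measurable_lfun_conj_comp.
- exact: measurable_lfun_conj_comp.
- by apply: filterS polar => w; exact: polar_decomposition_transport.
split.
- exact: haar_on_grassmannian_transport.
- split.
  + apply: filterS rankF => w <-; rewrite limg_comp dimT; congr (\dim _).
    by rewrite limg_comp (limg_fullv _ _ tK).
  + exact: conditionally_haar_transport.
  + exact: (independent_maps_linear (lfun_conj T t') (lfun_conj t t')).
split.
  move=> u v.
  (* Entries of the square of the conjugate at [(u, v)] are entries of the square of [S w] at
     [(t' u, t' v)]; scalar maps are unchanged by conjugation. *)
  have e w : hB ((lfun_conj t t' (S w) \o lfun_conj t t' (S w))%VF u) v =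
      gB ((S w \o S w)%VF (t' u)) (t' v).
    rewrite [X in hB X]comp_lfunE !(lfun_conjE _ t') comp_lfunE tK.
    by rewrite -{1}[v]t'K tiso.
  under eq_fun do rewrite e.
  have [? ->] := ES2 (t' u) (t' v); split => //; congr (_%:E).
  by rewrite -tiso t'K !scale_lfunE !id_lfunE linearZ /= t'K.
apply: le_lt_trans (op_norm_inv_conj_moment _ _) EinvS.
(* Positive definiteness makes [S w] injective: a nonzero [u - v] in its kernel would give
   [0 < 0]. *)
apply: filterS polar => w [_ _ _ [_ Spos]].
apply/lker0P => u v Suv; apply/eqP; rewrite -subr_eq0; apply/negP => /negP uv0.
by have := Spos _ uv0; rewrite linearB/= Suv subrr /restrict_ip !linear0l ltxx.
Qed.

End transport.

(** * Application to the tangent spaces at [x] and [x'] *)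

Theorem theorem2p16 (R : realType) (d : nat) (M : riemannianManifold R d)
    (x x' : M) (T : 'Hom(tangent x, tangent x'))
    (T_isometric : isometric (metric x) (metric x') T)
    (dsp : measure_display) (Omega : measurableType dsp)
    (P : probability Omega R)
    (l : nat) (B : {vspace tangent x}) (Xi : Omega -> {vspace tangent x})
    (F : Omega -> 'Hom(subvs_of B, tangent x))
    (dim_B : \dim B = l) (dim_Xi : forall w, \dim (Xi w) = l)
    (F_Xi : forall w, (limg (F w) <= Xi w)%VS)
    (F_full_rank : {ae P, forall w, \dim (limg (F w)) = l}) :
  let B' : {vspace tangent x'} := (T @: B)%VS in
  let Xi' : Omega -> {vspace tangent x'} := fun w => (T @: Xi w)%VS in
  let F' : Omega -> 'Hom(subvs_of B', tangent x') :=
    fun w => (T \o (F w \o (restrict_lfun T B)^-1))%VF in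
  haar_grassmann (metric x) P d l B Xi
    (fun w => sketching_operator (metric x) (F w)) ->
  haar_grassmann (metric x') P d l B' Xi'
    (fun w => sketching_operator (metric x') (F' w)).
Proof.
move=> B' Xi' F' cond.
(* The differential of a chart around [y] is bijective onto the row vectors of length [d]. Equal
   dimensions then make the injective map [T] onto. *)
have dim_tangent (y : M) : \dim {:tangent y} = d.
  have [a aA ay] := atlas_cover y.
  have [ker0 im] := dchart_bij aA ay.
  rewrite -(limg_ker_dim (dchart a y)) ker0 capv0 dimv0 im dimvf.
  by rewrite /dim /= mul1n.
have T_inj := isometric_inj _ _ _ T_isometric.
have T_full : limg T = fullv.
  by apply/eqP; rewrite eqEdim subvf dim_limg_inj//= !dim_tangent leqnn.
have TK : cancel T T^-1%VF by apply/lker0_lfunK/lker0P.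
have TVK : cancel T^-1%VF T.
  by move=> v; apply: limg_lfunVK; rewrite T_full memvf.
rewrite (_ : (fun w => _) = fun w =>
    lfun_conj T T^-1%VF (sketching_operator (metric x) (F w))).
  exact: haar_grassmann_transport.
apply/funext => w.
exact: (sketching_operator_transport (metric x) (metric x') T _ B TVK).
Qed.
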